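(* Assume that $v_0,e_0\in C_b^\infty(\mathbb T)$ are real-valued, that $e_0$ is positive, and that $\chi_0:=e_0-v_0^2>0$ on $\mathbb T$. Let $\kappa=1$, i.e. $\alpha_N=\alpha N^{-1}$. Let $\{(v^N_t(x),e^N_t(x))\}_{t\ge0,\,x\in\mathbb T_N}$ be the unique solution of the discrete system $$\partial_t v^N_t(x)=\Delta^N v^N_t(x)+2\alpha_N N\,\widetilde\nabla^N v^N_t(x),\qquad \partial_t e^N_t(x)=\Delta^N e^N_t(x)+2\alpha_N N\,\nabla^N\big(v^N_t(x-1)v^N_t(x)\big)$$ with initial conditions $v^N_0(x)=v_0(x/N)$, $e^N_0(x)=e_0(x/N)$, and let $\{(v(t,u),e(t,u))\}_{t\ge0,\,u\in\mathbb T}$ be the unique solution of $$\partial_t v=\Delta v+2\alpha\nabla v,\qquad \partial_t e=\Delta e+2\alpha\nabla v^2$$ with initial conditions $v(0,u)=v_0(u)$, $e(0,u)=e_0(u)$. Let $\mu_N$ be the product measure on $\Omega_N$ under which $\eta(x)$ is Gaussian with mean $v_0(x/N)$ and variance $\chi_0(x/N)$ for each $x\in\mathbb T_N$, and assume further that there is a constant $C_0>0$ such that the sequence $\{\mu_N\}_{N\in\mathbb N}$ satisfies $$\limsup_{N\to\infty}\mathbb E_N\big[\|\eta_0^2\|_{-1,N}^2\big]\le C_0\qquad\text{and}\qquad \limsup_{N\to\infty}\,N\max_{(x,y)\in V_N^{(2)}}|\varphi^N_0(x,y)|\le C_0.$$ Then there exists $C=C(T,v_0,e_0)>0$ such that $$\sup_{0\le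 t\le T}\ \max_{x\in\mathbb T_N}\big|e^N_t(x)-e(t,x/N)\big|\le C\,\frac{\log N}{N}.$$
   Context: Notation. $\mathbb T_N=\mathbb Z/(N\mathbb Z)$ is the discrete torus, $\mathbb T=\mathbb R/\mathbb Z$ the unit torus, $\nabla=\partial_u$ and $\Delta=\partial_u^2$ on $\mathbb T$, and $T>0$ is a fixed time horizon. For $g=(g_x)_{x\in\mathbb T_N}$: $\nabla^N g_x=N(g_{x+1}-g_x)$, $\widetilde\nabla^N g_x=\frac N2(g_{x+1}-g_{x-1})$, $\Delta^N g_x=N^2(g_{x+1}+g_{x-1}-2g_x)$; in the discrete energy equation $\nabla^N$ acts on the sequence $x\mapsto v^N_t(x-1)v^N_t(x)$. Model. $\Omega_N=\mathbb R^{\mathbb T_N}$ and $\alpha_N=\alpha N^{-\kappa}$ with $\alpha>0$ fixed. $\{\eta_t(x):x\in\mathbb T_N,t\ge0\}$ is the Markov process on $\Omega_N$ with generator $L_N=N^2S+\alpha_NN^2A$ and initial law $\mu_N$, where $Sf(\eta)=\sum_{x\in\mathbb T_N}(f(\eta^{x,x+1})-f(\eta))$, $Af(\eta)=\sum_{x\in\mathbb T_N}(\eta(x+1)-\eta(x-1))\,\partial f/\partial\eta(x)$, and $\eta^{x,y}$ is $\eta$ with the values at $x$ and $y$ exchanged. $\mathbb E_N$ is the corresponding expectation. The initial two-point volume correlation is $\varphi^N_0(x,y)=\mathbb E_N[\eta_0(x)\eta_0(y)]-\mathbb E_N[\eta_0(x)]\,\mathbb E_N[\eta_0(y)]$ for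 $(x,y)\in V_N^{(2)}=\{(x,y)\in\mathbb T_N^2:x\ne y\}$. Discrete negative norm. $\|f\|_{-1,N}^2=\frac1N\sum_{x,y\in\mathbb T_N}f(x)K_N(x-y)\overline{f(y)}$ with $K_N(x)=\frac1N\sum_{z\in\mathbb T_N}\frac{e^{2\pi i zx/N}}{1+2N^2(1-\cos(2\pi z/N))}$; $\|\eta_0^2\|_{-1,N}$ is the norm of $x\mapsto\eta_0(x)^2$. *)

(* Defs.v *)
From HB Require Import structures.
From mathcomp Require Import all_boot all_order all_algebra.
From mathcomp Require Import complex.
From mathcomp Require Import all_classical all_reals all_analysis.
Set Implicit Arguments.
Unset Strict Implicit.
Unset Printing Implicit Defensive.
Import Order.TTheory GRing.Theory Num.Theory.
Import numFieldNormedType.Exports.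
Local Open Scope classical_set_scope.
Local Open Scope complex_scope.
Local Open Scope ring_scope.

(** Functions on the torus R/Z are represented by 1-periodic functions on R;
    the discrete torus Z/NZ by ['I_N], with [ordS] and [ord_pred] as the
    cyclic translations x |-> x + 1 and x |-> x - 1 (here N > 0). *)

Definition periodic1 (R : realType) (f : R -> R) : Prop :=
  forall u, f (u + 1) = f u.

Definition Cb_infty_torus (R : realType) (f : R -> R) : Prop :=
  periodic1 f /\
  forall n : nat, (forall u, derivable (derive1n n f) u 1) /\
                  (exists M : R, forall u, `|derive1n n f u| <= M).

Definition pt (R : realType) (N : nat) (x : 'I_N) : R := x%:R / N%:R.

Definition gradN (R : realType) (N : nat) (g : 'I_N -> R) (x : 'I_N) : R :=
  N%:R * (g (ordS x) - g x).

Definition sgradN (R : realType) (N : nat) (g : 'I_N -> R) (x : 'I_N) : R :=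
  N%:R / 2 * (g (ordS x) - g (ord_pred x)).

Definition lapN (R : realType) (N : nat) (g : 'I_N -> R) (x : 'I_N) : R :=
  N%:R ^+ 2 * (g (ordS x) + g (ord_pred x) - 2 * g x).

Definition alphaN (R : realType) (alpha kappa : R) (N : nat) : R :=
  alpha * N%:R `^ (- kappa).

(** Solutions on [0, +oo[: the equations hold at every t > 0 and the initial
    value is attained continuously.  For the discrete system this gives the
    equation at t = 0 as well, with a right derivative. *)

Definition discrete_solution (R : realType) (N : nat) (a : R) (v0 e0 : R -> R)
    (v e : R -> 'I_N -> R) : Prop :=
  [/\ forall x, v 0 x = v0 (pt R x) /\ e 0 x = e0 (pt R x),
      forall x, {within `[0, +oo[, continuous (fun t : R => v t x)} /\
                {within `[0, +oo[, continuous (fun t : R => e t x)},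
      forall (t : R) (x : 'I_N), 0 < t ->
        is_derive t 1 (fun s : R => v s x)
          (lapN (v t) x + 2 * a * N%:R * sgradN (v t) x) &
      forall (t : R) (x : 'I_N), 0 < t ->
        is_derive t 1 (fun s : R => e s x)
          (lapN (e t) x
           + 2 * a * N%:R * gradN (fun y => v t (ord_pred y) * v t y) x)].

Definition classical_regularity (R : realType) (f : R -> R -> R) : Prop :=
  [/\ forall t : R, 0 <= t -> periodic1 (f t),
      {within [set p : R * R | 0 <= p.1], continuous (fun p => f p.1 p.2)},
      forall t u : R, 0 < t -> derivable (fun s => f s u) t 1 &
      forall t u : R, 0 < t ->
        derivable (f t) u 1 /\ derivable (derive1 (f t)) u 1].

Definition pde_solution (R : realType) (alpha : R) (v0 e0 : R -> R)
    (v e : R -> R -> R) : Prop :=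
  [/\ classical_regularity v /\ classical_regularity e,
      forall u, v 0 u = v0 u /\ e 0 u = e0 u,
      forall t u : R, 0 < t ->
        derive1 (fun s => v s u) t
        = derive1n 2 (v t) u + 2 * alpha * derive1 (v t) u &
      forall t u : R, 0 < t ->
        derive1 (fun s => e s u) t
        = derive1n 2 (e t) u + 2 * alpha * derive1 (fun w => v t w ^+ 2) u].

Definition config (R : realType) (N : nat) := N.-tuple (measurableTypeR R).

(** [normal_prob] takes the standard deviation, hence the square root. *)
Definition gaussian_product (R : realType) (N : nat) (m s2 : 'I_N -> R)
    (mu : probability (config R N) R) : Prop :=
  forall B : 'I_N -> set (measurableTypeR R), (forall x, measurable (B x)) ->
    mu [set eta | forall x, B x (tnth eta x)]
    = (\prod_(x < N) normal_prob (m x) (Num.sqrt (s2 x)) (B x))%E.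

Definition expi (R : realType) (theta : R) : R[i] := cos theta +i* sin theta.

(** [kernelN N] is N-periodic in its integer argument, so that the difference
    of two elements of the discrete torus may be taken in [int]. *)
Definition kernelN (R : realType) (N : nat) (x : int) : R[i] :=
  (N%:R)^-1 *
  \sum_(z < N) expi (2 * pi * z%:R * x%:~R / N%:R : R)
    / (1 + 2 * N%:R ^+ 2 * (1 - cos (2 * pi * z%:R / N%:R)))%:C.

(** The Hermitian form below is real-valued; [complex.Re] only changes the
    type of the result. *)
Definition sqnorm_m1 (R : realType) (N : nat) (f : 'I_N -> R[i]) : R :=
  complex.Re ((N%:R)^-1 *
    \sum_(x < N) \sum_(y < N)
      f x * kernelN R N (x%:Z - y%:Z) * conjc (f y)).

(** Expectations of functions of the initial configuration eta_0, whose law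
    is [mu]. *)
Definition mean_sqnorm_m1 (R : realType) (N : nat)
    (mu : probability (config R N) R) : \bar R :=
  'E_mu[(fun eta => sqnorm_m1 (fun x : 'I_N => ((tnth eta x : R) ^+ 2)%:C))].

Definition volume_correlation (R : realType) (N : nat)
    (mu : probability (config R N) R) (x y : 'I_N) : \bar R :=
  ('E_mu[(fun eta => (tnth eta x : R) * tnth eta y)%R]
   - 'E_mu[(fun eta => tnth eta x : R)] * 'E_mu[(fun eta => tnth eta y : R)])%E.

Definition max_volume_correlation (R : realType) (N : nat)
    (mu : probability (config R N) R) : \bar R :=
  (\big[maxe/0]_(p : 'I_N * 'I_N | p.1 != p.2)
     `|volume_correlation mu p.1 p.2|)%E.

(* Main.v *)
Require Import Defs.
From HB Require Import structures.
From mathcomp Require Import all_boot all_order all_algebra.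
From mathcomp Require Import complex.
From mathcomp Require Import all_classical all_reals all_analysis.
From mathcomp Require Import ring lra.
Import Order.TTheory GRing.Theory Num.Theory.
Import numFieldNormedType.Exports.
Local Open Scope ring_scope.

(** Both systems are deterministic and parabolic, so the comparison is a
    consistency estimate followed by a stability estimate, and the maximum
    principle supplies both; the rate it gives, 1/N, is better than
    (log N)/N.

    Regularity.  The solution (v, e) of the continuous system is only assumed
    to be classical, while consistency needs bounds on more derivatives, with
    constants that depend on the initial data alone.  They come from difference
    quotients: the equations are invariant under translation, so
    u |-> (v(t, u + h) - v(t, u)) / h solves the same equation as v, and the
    maximum principle ([heat_maximum_principle]) bounds it by its initial
    value.  Iterating, all difference quotients of v(t, .) up to order 4 are
    bounded by those of v_0, uniformly in the steps
    ([advected_heat_dquot_bounded]).  The same argument with the source term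
    2 alpha (v^2)_u = 4 alpha v v_u bounds the quotients of e(t, .) up to
    order 3.  Such bounds pass to the derivatives
    ([dquot_bounded_derive]) and stand in for bounds on higher derivatives in
    the Taylor estimates.

    Velocity.  On the lattice of mesh h = 1/N the centred operators are
    consistent to order h^2 with v_uu and v_u.  The difference
    w = v^N - v solves the discrete equation with a source O(h^2) and vanishes
    at time 0, hence w = O(h^2) ([velocity_error]).  A discrete maximum
    principle in the usual form would require N >= alpha, for the off-diagonal
    coefficients N^2 +- alpha N to be nonnegative; the negative part of
    these coefficients is bounded uniformly in N, so that for every N it only
    costs an exponential factor in time ([discrete_stability]).

    Energy.  The gradient of the discrete flux is centred in x,
    N (v(x) v(x+1) - v(x-1) v(x)) = 2 v(x) * (N/2) (v(x+1) - v(x-1)).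
    Differentiating w on the lattice loses one factor N, and the
    flux error is therefore O(h^2) * N = O(h) ([energy_flux_error]).
    With the O(h) consistency of the Laplacian on e, the stability estimate
    gives e^N - e = O(1/N) ([energy_error]), and ln N >= ln 2 concludes. *)

(** * Difference quotients and Taylor estimates *)

Definition dquot {R : realType} (h : R) (f : R -> R) (u : R) : R :=
  h^-1 * (f (u + h) - f u).

(** A substitute for a bound on the derivatives of order at most [k] that makes
    sense for functions not known to be [k] times differentiable.  The
    step of each of the successive quotients is arbitrary, and different
    steps may be mixed. *)
Fixpoint dquot_bounded {R : realType} (k : nat) (M : R) (f : R -> R) : Prop :=
  (forall u, `|f u| <= M) /\
  (if k is k'.+1 then forall h, h != 0 -> dquot_bounded k' M (dquot h f)
   else True).

Section Calculus.
Set Implicit Arguments.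
Unset Strict Implicit.
Unset Printing Implicit Defensive.
Local Open Scope classical_set_scope.
Local Open Scope ring_scope.
Variable R : realType.
Implicit Types (f g df dg : R -> R) (u h s t d c M : R).

(** The derivation rules of the library are stated for the ring operations on
    functions; these forms unify with explicit abstractions. *)
Lemma is_derive_lambdaD f g u a b : is_derive u 1 f a -> is_derive u 1 g b ->
  is_derive u 1 (fun s => f s + g s) (a + b).
Proof. exact: is_deriveD. Qed.

Lemma is_derive_lambdaB f g u a b : is_derive u 1 f a -> is_derive u 1 g b ->
  is_derive u 1 (fun s => f s - g s) (a - b).
Proof. exact: is_deriveB. Qed.

Lemma is_derive_lambdaZ c f u a : is_derive u 1 f a ->
  is_derive u 1 (fun s => c * f s) (c * a).
Proof. exact: is_deriveZ. Qed.

Lemma is_derive_lambdaM f g u a b : is_derive u 1 f a -> is_derive u 1 g b ->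
  is_derive u 1 (fun s => f s * g s) (a * g u + f u * b).
Proof.
by move=> fa gb; apply: is_derive_eq (is_deriveM _ _) _; rewrite /GRing.scale/=; ring.
Qed.

Lemma is_derive_translate f u h a : is_derive (u + h) 1 f a ->
  is_derive u 1 (fun s => f (s + h)) a.
Proof.
move=> fa; rewrite -[a]mulr1.
exact: (@is_derive1_comp _ f (shift h) u a 1 fa (is_derive_shift _ _ _)).
Qed.

Lemma is_derive_translatel f u h a : is_derive (u + h) 1 f a ->
  is_derive h 1 (fun s => f (u + s)) a.
Proof.
by move=> fa; under eq_fun do rewrite addrC; apply: is_derive_translate; rewrite addrC.
Qed.

Lemma is_derive_reflect f u h a : is_derive (u - h) 1 f a ->
  is_derive h 1 (fun s => f (u - s)) (- a).
Proof.
move=> fa; rewrite -[- a]mulrN1.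
have gd : is_derive h 1 (fun s => u - s) (-1).
  rewrite -[-1]add0r; apply: is_derive_lambdaD; exact: is_derive_cst.
exact: (@is_derive1_comp _ f (fun s => u - s) h a (-1) fa gd).
Qed.

Lemma is_derive_cvg f u a : is_derive u 1 f a ->
  dquot h f u @[h --> 0^'] --> a.
Proof.
move=> [df <-]; suff <- : (fun h => h^-1 *: ((f \o shift u) (h *: 1) - f u)) =
    (fun h => dquot h f u) by [].
by apply/funext => h; rewrite /= [h%:A]mulr1 (addrC h).
Qed.

Lemma mean_value_step f df u h : 0 <= h ->
  (forall s, u <= s <= u + h -> is_derive s 1 f (df s)) ->
  exists2 c, u <= c <= u + h & f (u + h) - f u = df c * h.
Proof.
move=> h0 fd.
have [|s||c] := @MVT_segment R f df u (u + h).
- by rewrite lerDl.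
- by rewrite in_itv/= => /andP[us sh]; apply: fd; rewrite !ltW.
- apply: derivable_within_continuous => x; rewrite in_itv/= => xu.
  by have [] := fd x xu.
- rewrite in_itv/= => cu ->; exists c => //; congr (_ * _); ring.
Qed.

Lemma increment_le f df M u h : (forall s, is_derive s 1 f (df s)) ->
  (forall s, `|df s| <= M) -> `|f (u + h) - f u| <= M * `|h|.
Proof.
move=> fd dM; have [h0|h0] := leP 0 h.
  have fd' s : u <= s <= u + h -> is_derive s 1 f (df s) by [].
  have [c _ ->] := mean_value_step h0 fd'.
  by rewrite normrM ler_wpM2r.
have hN : 0 <= - h by rewrite oppr_ge0 ltW.
have fd' s : u + h <= s <= u + h + - h -> is_derive s 1 f (df s) by [].
have [c _] := mean_value_step hN fd'.
rewrite addrK => E; rewrite distrC E normrM normrN ler_wpM2r//.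
Qed.

Lemma dquot_derive h f u a b :
  is_derive (u + h) 1 f a -> is_derive u 1 f b ->
  is_derive u 1 (dquot h f) (h^-1 * (a - b)).
Proof.
move=> fa fb; apply: is_derive_lambdaZ; apply: is_derive_lambdaB => //.
exact: is_derive_translate.
Qed.

Lemma dquot_bounded_norm k M f u : dquot_bounded k M f -> `|f u| <= M.
Proof. by case: k => [|k] []. Qed.

Lemma dquot_bounded_ge0 k M f : dquot_bounded k M f -> 0 <= M.
Proof. by move/(dquot_bounded_norm 0); exact: le_trans. Qed.

Lemma dquot_boundedW k M f : dquot_bounded k.+1 M f -> dquot_bounded k M f.
Proof.
elim: k f => [|k IH] f [fM fh]; split => //.
by move=> h h0; apply: IH; exact: fh.
Qed.

Lemma dquot_bounded_translate k M f c : dquot_bounded k M f ->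
  dquot_bounded k M (fun u => f (u + c)).
Proof.
elim: k f => [|k IH] f [fM fh]; split => // h h0.
suff -> : dquot h (fun u => f (u + c)) = fun u => dquot h f (u + c).
  by apply: IH; exact: fh.
by apply/funext => u; rewrite /dquot addrAC.
Qed.

Lemma dquot_boundedD k A B f g :
  dquot_bounded k A f -> dquot_bounded k B g ->
  dquot_bounded k (A + B) (fun u => f u + g u).
Proof.
have fgAB (p q : R -> R) u : `|p u| <= A -> `|q u| <= B -> `|p u + q u| <= A + B.
  by move=> pA qB; apply: le_trans (ler_normD _ _) (lerD pA qB).
elim: k f g => [|k IH] f g [fM fh] [gM gh]; split => //.
- by move=> u; exact: fgAB.
- by move=> u; exact: fgAB.
move=> h h0.
suff -> : dquot h (fun u => f u + g u) = fun u => dquot h f u + dquot h g u.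
  by apply: IH; [exact: fh|exact: gh].
by apply/funext => u; rewrite /dquot; ring.
Qed.

Lemma dquot_boundedZ k A c f : dquot_bounded k A f ->
  dquot_bounded k (`|c| * A) (fun u => c * f u).
Proof.
elim: k f => [|k IH] f [fM fh]; split => //.
- by move=> u; rewrite normrM ler_wpM2l.
- by move=> u; rewrite normrM ler_wpM2l.
move=> h h0.
suff -> : dquot h (fun u => c * f u) = fun u => c * dquot h f u.
  by apply: IH; exact: fh.
by apply/funext => u; rewrite /dquot; ring.
Qed.

(** Discrete Leibniz rule:
    D_h (f g) = (D_h f) (g translated by h) + f (D_h g); each order doubles
    the number of terms. *)
Lemma dquot_boundedM k A B f g :
  dquot_bounded k A f -> dquot_bounded k B g ->
  dquot_bounded k (2 ^+ k * (A * B)) (fun u => f u * g u).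
Proof.
elim: k f g => [|k IH] f g fk gk.
  split=> // u; rewrite expr0 mul1r normrM.
  by apply: ler_pM => //; [case: fk|case: gk].
have A0 := dquot_bounded_ge0 fk; have B0 := dquot_bounded_ge0 gk.
have [[fM fh] [gM gh]] := (fk, gk).
split.
  move=> u; rewrite normrM; apply: (@le_trans _ _ (A * B)).
    exact: ler_pM.
  by rewrite ler_peMl ?mulr_ge0// exprn_ege1// ler1n.
move=> h h0.
have -> : dquot h (fun u => f u * g u) =
    fun u => dquot h f u * g (u + h) + f u * dquot h g u.
  by apply/funext => u; rewrite /dquot; ring.
rewrite exprS -mulrA [2 * _]mulrDl mul1r.
apply: dquot_boundedD; apply: IH.
- exact: fh.
- exact/dquot_bounded_translate/dquot_boundedW.
- exact: dquot_boundedW.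
- exact: gh.
Qed.

(** The derivative is a pointwise limit of difference quotients, and it
    commutes with [dquot h]; bounds are preserved by both. *)
Lemma dquot_bounded_derive k M f df : (forall u, is_derive u 1 f (df u)) ->
  dquot_bounded k.+1 M f -> dquot_bounded k M df.
Proof.
have dfM f' df' u k' : is_derive u 1 f' (df' u) ->
    dquot_bounded k'.+1 M f' -> `|df' u| <= M.
  move=> /is_derive_cvg fd fM.
  have /cvgr_to_le : `|dquot h f' u| @[h --> 0^'] --> `|df' u| by exact: cvg_norm.
  apply.
  near=> h; have [_ fh] := fM.
  apply: (@dquot_bounded_norm k'); apply: fh.
  near: h; exact: nbhs_dnbhs_neq.
elim: k f df => [|k IH] f df fd fM; split => //.
- by move=> u; exact: dfM (fd u) fM.
- by move=> u; exact: dfM (fd u) fM.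
move=> h h0; apply: (IH (dquot h f)); last by case: fM => _; exact.
by move=> u; exact: dquot_derive.
Unshelve. all: by end_near. Qed.

(** The induction applies to the whole sequence of derivatives at once: the
    quotients [dquot h (F j)] again form such a sequence, bounded by
    the mean value theorem with one order less. *)
Lemma dquot_bounded_smooth k M (F : nat -> R -> R) :
  (forall j u, is_derive u 1 (F j) (F j.+1 u)) ->
  (forall j u, (j <= k)%N -> `|F j u| <= M) ->
  dquot_bounded k M (F 0%N).
Proof.
elim: k F => [|k IH] F Fd FM; split => //.
- by move=> u; exact: FM.
- by move=> u; exact: FM.
move=> h h0; apply: (IH (fun j => dquot h (F j))).
  by move=> j u; exact: dquot_derive.
move=> j u jk; rewrite /dquot normrM normfV ler_pdivrMl ?normr_gt0// mulrC.
by apply: increment_le => // s; exact: FM.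
Qed.

Lemma lipschitz_of_dquot k M f u h : dquot_bounded k.+1 M f ->
  `|f (u + h) - f u| <= M * `|h|.
Proof.
have [->|h0] := eqVneq h 0; first by rewrite addr0 subrr !normr0 mulr0.
move=> [_ /(_ h h0)/(dquot_bounded_norm u)].
by rewrite /dquot normrM normfV ler_pdivrMl ?normr_gt0// mulrC.
Qed.

(** The centred second difference is h^2 times the double quotient with step
    h, based at u - h. *)
Lemma second_difference_of_dquot k M f u h : dquot_bounded k.+2 M f ->
  `|f (u + h) + f (u - h) - 2 * f u| <= M * h ^+ 2.
Proof.
have [->|h0] := eqVneq h 0.
  move=> _; rewrite subr0 addr0 expr0n mulr0 normr_le0.
  by apply/eqP; ring.
move=> [_ /(_ h h0)[_ /(_ h h0)]] /(dquot_bounded_norm (u - h)).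
have -> : dquot h (dquot h f) (u - h)
    = (h ^+ 2)^-1 * (f (u + h) + f (u - h) - 2 * f u).
  by rewrite /dquot subrK; field.
rewrite normrM normfV ler_pdivrMl ?normr_gt0 ?expf_neq0//.
by rewrite (mulrC M) normrX real_normK ?num_real.
Qed.

(** The mean value theorem replaces integration: only the factor 1/(n+1) is
    lost, not the power of [h]. *)
Lemma primitive_power_bound n M f df h : 0 <= h -> f 0 = 0 -> 0 <= M ->
  (forall s, 0 <= s <= h -> is_derive s 1 f (df s)) ->
  (forall s, 0 <= s <= h -> `|df s| <= M * s ^+ n) ->
  `|f h| <= M * h ^+ n.+1.
Proof.
move=> h0 f0 M0 fd dM.
have [|c] := @mean_value_step f df 0 h h0; first by move=> s; rewrite add0r; exact: fd.
rewrite add0r f0 subr0 => ch ->; rewrite normrM (ger0_norm h0) exprSr mulrA.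
apply: ler_wpM2r => //; apply: le_trans (dM _ ch) _.
have /andP[c0 ch'] := ch.
by apply: ler_wpM2l => //; rewrite lerXn2r// nnegrE.
Qed.

(** As a function of the step s, the error f(u+s) - f(u-s) - 2 s f'(u) vanishes
    at 0 and its derivative is a second difference of f'. *)
Lemma centered_difference_truncation M f df u h : 0 < h ->
  (forall s, is_derive s 1 f (df s)) -> dquot_bounded 2 M df ->
  `|h^-1 * (f (u + h) - f (u - h)) - 2 * df u| <= M * h ^+ 2.
Proof.
move=> h0 fd dM; have M0 := dquot_bounded_ge0 dM.
suff : `|f (u + h) - f (u - h) - h * (2 * df u)| <= M * h ^+ 3.
  have -> : f (u + h) - f (u - h) - h * (2 * df u) =
    h * (h^-1 * (f (u + h) - f (u - h)) - 2 * df u) by field; exact: lt0r_neq0.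
  rewrite normrM (gtr0_norm h0) [h ^+ 3]exprSr mulrA mulrC => H.
  by rewrite -(ler_pM2r h0).
apply: (@primitive_power_bound 2 M (fun s => f (u + s) - f (u - s) - s * (2 * df u))
   (fun s => df (u + s) + df (u - s) - 2 * df u)) => //.
- exact: ltW.
- by rewrite addr0 subr0; ring.
- move=> s _.
  have -> : df (u + s) + df (u - s) - 2 * df u
     = df (u + s) - (- df (u - s)) - (1 * (2 * df u) + s * 0) by ring.
  apply: is_derive_lambdaB.
    apply: is_derive_lambdaB; last exact: is_derive_reflect.
    exact: is_derive_translatel.
  exact: (is_derive_lambdaM (is_derive_id _ _) (is_derive_cst _ _ _)).
- move=> s _; exact: second_difference_of_dquot dM.
Qed.

(** The error f(u+s) + f(u-s) - 2 f(u) - s^2 f''(u) vanishes at s = 0 together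
    with its derivative, and its second derivative is the second difference of
    f''.  The exponent [n] measures the regularity available for f''. *)
Lemma laplacian_truncation n K f df ddf u h : 0 < h -> 0 <= K ->
  (forall s, is_derive s 1 f (df s)) -> (forall s, is_derive s 1 df (ddf s)) ->
  (forall s, 0 <= s ->
     `|ddf (u + s) + ddf (u - s) - 2 * ddf u| <= K * s ^+ n) ->
  `|h ^- 2 * (f (u + h) + f (u - h) - 2 * f u) - ddf u| <= K * h ^+ n.
Proof.
move=> h0 K0 fd dd dK.
suff : `|f (u + h) + f (u - h) - 2 * f u - h ^+ 2 * ddf u| <= K * h ^+ n.+2.
  have -> : f (u + h) + f (u - h) - 2 * f u - h ^+ 2 * ddf u =
     h ^+ 2 * (h ^- 2 * (f (u + h) + f (u - h) - 2 * f u) - ddf u).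
    by field; exact: lt0r_neq0.
  have -> : K * h ^+ n.+2 = K * h ^+ n * h ^+ 2 by rewrite -(addn2 n) exprD mulrA.
  rewrite normrM ger0_norm ?sqr_ge0// mulrC.
  by rewrite ler_pM2r// exprn_gt0.
apply: (@primitive_power_bound n.+1 K
   (fun s => f (u + s) + f (u - s) - 2 * f u - s ^+ 2 * ddf u)
   (fun s => df (u + s) - df (u - s) - s * (2 * ddf u))) => //.
- exact: ltW.
- by rewrite addr0 subr0 expr0n mul0r; ring.
- move=> s _.
  have -> : df (u + s) - df (u - s) - s * (2 * ddf u) =
    df (u + s) + - df (u - s) - 0 - ((1 * s + s * 1) * ddf u + s ^+ 2 * 0) by ring.
  apply: is_derive_lambdaB.
    apply: is_derive_lambdaB.
    apply: is_derive_lambdaD; last exact: is_derive_reflect.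
    exact: is_derive_translatel.
  apply: is_derive_lambdaM.
  exact: (is_derive_lambdaM (is_derive_id _ _) (is_derive_id _ _)).
- move=> s /andP[s0 _].
  apply: (@primitive_power_bound n K
     (fun s => df (u + s) - df (u - s) - s * (2 * ddf u))
     (fun s => ddf (u + s) + ddf (u - s) - 2 * ddf u)) => //.
  + by rewrite addr0 subr0 mul0r; ring.
  + move=> r _.
    have -> : ddf (u + r) + ddf (u - r) - 2 * ddf u =
        ddf (u + r) - (- ddf (u - r)) - (1 * (2 * ddf u) + r * 0) by ring.
    apply: is_derive_lambdaB.
      apply: is_derive_lambdaB; last exact: is_derive_reflect.
      exact: is_derive_translatel.
    exact: (is_derive_lambdaM (is_derive_id _ _) (is_derive_cst _ _ _)).
  + by move=> r /andP[r0 _]; exact: dK.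
Qed.

Lemma laplacian_truncation_quadratic M f df ddf u h : 0 < h ->
  (forall s, is_derive s 1 f (df s)) -> (forall s, is_derive s 1 df (ddf s)) ->
  dquot_bounded 2 M ddf ->
  `|h ^- 2 * (f (u + h) + f (u - h) - 2 * f u) - ddf u| <= M * h ^+ 2.
Proof.
move=> h0 fd dd dM; apply: laplacian_truncation fd dd _ => //.
  exact: dquot_bounded_ge0 dM.
by move=> s _; exact: second_difference_of_dquot dM.
Qed.

Lemma laplacian_truncation_linear M f df ddf u h : 0 < h ->
  (forall s, is_derive s 1 f (df s)) -> (forall s, is_derive s 1 df (ddf s)) ->
  dquot_bounded 1 M ddf ->
  `|h ^- 2 * (f (u + h) + f (u - h) - 2 * f u) - ddf u| <= 2 * M * h.
Proof.
move=> h0 fd dd dM; rewrite -[leRHS]/(2 * M * h ^+ 1).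
apply: laplacian_truncation fd dd _ => //.
  by rewrite mulr_ge0// (dquot_bounded_ge0 dM).
move=> s s0; rewrite expr1.
have -> : ddf (u + s) + ddf (u - s) - 2 * ddf u =
  (ddf (u + s) - ddf u) + (ddf (u + - s) - ddf u) by ring.
rewrite (le_trans (ler_normD _ _))//.
have H r := lipschitz_of_dquot u r dM.
rewrite (le_trans (lerD (H s) (H (- s))))// normrN ger0_norm//; lra.
Qed.

End Calculus.

(** * Maximum principles *)

Section MaximumPrinciple.
Set Implicit Arguments.
Unset Strict Implicit.
Unset Printing Implicit Defensive.
Local Open Scope classical_set_scope.
Local Open Scope ring_scope.
Variable R : realType.
Implicit Types (f g df ddf : R -> R) (u h s t d c M : R).

(** Only the left difference quotients have a known sign here: the maximum may
    be attained at the end of the time interval. *)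
Lemma derive_ge0_at_right_end f t d : 0 < t -> is_derive t 1 f d ->
  (forall s, 0 <= s <= t -> f s <= f t) -> 0 <= d.
Proof.
move=> t0 /is_derive_cvg fd fmax; rewrite leNgt; apply/negP => d0.
have : \forall h \near 0^', dquot h f t < 0 by exact: cvgr_lt fd _ d0.
move=> [r /= r0 rP].
(* small enough for the limit, and such that t + h stays in [0, t] *)
pose h := - Num.min (r / 2) t.
have m0 : 0 < Num.min (r / 2) t by rewrite lt_min t0 divr_gt0.
have : dquot h f t < 0.
  apply: rP; last by rewrite /h oppr_eq0 gt_eqF.
  rewrite /= sub0r /h opprK gtr0_norm// gt_min; apply/orP; left; lra.
apply/negP; rewrite -leNgt /dquot.
rewrite -mulrNN mulr_ge0//.
  by rewrite -invrN invr_ge0 /h opprK ltW.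
rewrite oppr_ge0 subr_le0; apply: fmax.
rewrite /h subr_ge0 ge_min lexx orbT/= gerBl; exact: ltW.
Qed.

Lemma second_derivative_test f df ddfu u :
  (forall s, is_derive s 1 f (df s)) -> is_derive u 1 df ddfu ->
  (forall s, f s <= f u) -> df u = 0 /\ ddfu <= 0.
Proof.
move=> fd dd fmax.
have dfu : df u = 0.
  have uu : u \in `]u - 1, u + 1[ by rewrite in_itv/=; apply/andP; split; lra.
  have fu t : t \in `]u - 1, u + 1[ -> derivable f t 1.
    by move=> _; have [] := fd t.
  have uu' : u - 1 <= u + 1 by lra.
  have [_ <-] := derive1_at_max uu' fu uu (fun t _ => fmax t).
  by have [_ ->] := fd u.
split=> //; rewrite leNgt; apply/negP => d0.
have : \forall h \near 0^', 0 < dquot h df u by exact: cvgr_gt (is_derive_cvg dd) _ d0.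
move=> [r /= r0 rP].
have r2 : 0 <= r / 2 by rewrite divr_ge0// ltW.
have [||c] := @MVT R f df u (u + r / 2).
- by rewrite ltrDl divr_gt0.
- by apply: derivable_within_continuous => x _; have [] := fd x.
rewrite in_itv/= => /andP[uc cr] E.
have : 0 < dquot (c - u) df u.
  apply: rP; last by rewrite subr_eq0 gt_eqF.
  rewrite /= sub0r normrN gtr0_norm ?subr_gt0//; lra.
rewrite /dquot dfu subr0 (addrC u) subrK pmulr_rgt0 ?invr_gt0 ?subr_gt0// => dc.
have : 0 < f (u + r / 2) - f u by rewrite E mulr_gt0//; lra.
by rewrite subr_gt0 ltNge fmax.
Qed.

(** Maximum principle, with the space variable in an arbitrary type: [I] will be
    the space times [bool], the boolean carrying a sign so that the bound is on
    absolute values.  Were the maximum of Z - c t, with c > G, attained at a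
    positive time, the time derivative there would be at least c, whereas a
    spatial maximum allows at most G.  The existence of the maximum is a
    hypothesis because compactness has different sources in the
    applications. *)
Lemma parabolic_comparison (I : Type) (Z : R -> I -> R) (T A G : R) :
  (forall i, Z 0 i <= A) ->
  (forall c, exists t i, 0 <= t <= T /\
     forall s j, 0 <= s <= T -> Z s j - c * s <= Z t i - c * t) ->
  (forall t i, 0 < t <= T -> (forall j, Z t j <= Z t i) ->
     exists2 d, is_derive t 1 (Z^~ i) d & d <= G) ->
  forall t i, 0 <= t <= T -> Z t i <= A + G * t.
Proof.
move=> Z0 Zmax Zd t i tT; apply/ler_addgt0Pr => e e0.
have /andP[t0 _] := tT.
(* the excess of the slope over G costs at most e up to time t *)
pose c := G + e / (t + 1).
have [s [j [/andP[s0 sT] sjmax]]] := Zmax c.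
have ct : c * t <= G * t + e.
  rewrite /c mulrDl lerD2l mulrAC ler_pdivrMr; last lra.
  by rewrite mulrDr mulr1 lerDl ltW.
have [s_eq0|s_neq0] := eqVneq s 0.
  have := sjmax t i tT; have := Z0 j; rewrite s_eq0 mulr0 subr0; lra.
have s_gt0 : 0 < s by rewrite lt_def s_neq0.
have [|k|d sd dG] := Zd s j; first by rewrite s_gt0.
  by have := sjmax s k; rewrite lerD2r; apply; rewrite s0.
have : is_derive s 1 (fun r => Z r j - c * r) (d - c * 1).
  apply: is_derive_lambdaB => //; exact: is_derive_lambdaZ.
move=> /(derive_ge0_at_right_end s_gt0) H.
have : 0 <= d - c * 1.
  by apply: H => r /andP[r0 rs]; apply: sjmax; rewrite r0 (le_trans rs).
have : 0 < e / (t + 1) by rewrite divr_gt0//; lra.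
rewrite /c; lra.
Qed.

End MaximumPrinciple.

(** * Heat equations with constant drift on the torus *)

(** Classical solutions of w_t = w_uu + b w_u + g.  The derivatives are explicit
    data, so that they can be transformed together with [w]; continuity up
    to time 0 is expressed by freezing [w] at its initial value for negative
    times, which gives a condition on the whole plane. *)
Definition advected_heat {R : realType} (b : R) (g w wu wuu : R -> R -> R) : Prop :=
  [/\ forall t : R, 0 <= t -> periodic1 (w t),
      continuous (fun p : R * R => w (Num.max 0 p.1) p.2),
      forall t u : R, 0 < t ->
        is_derive u 1 (w t) (wu t u) /\ is_derive u 1 (wu t) (wuu t u) &
      forall t u : R, 0 < t ->
        is_derive t 1 (fun s => w s u) (wuu t u + b * wu t u + g t u)].

Section HeatEquation.
Set Implicit Arguments.
Unset Strict Implicit.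
Unset Printing Implicit Defensive.
Local Open Scope classical_set_scope.
Local Open Scope ring_scope.
Variable R : realType.
Implicit Types (f : R -> R) (g w wu wuu : R -> R -> R) (u h s t b A G T : R).

Lemma continuous_comp_within (X Y W : topologicalType) (D : set Y) (f : Y -> W)
    (phi : X -> Y) :
  {within D, continuous f} -> continuous phi -> (forall x, D (phi x)) ->
  continuous (f \o phi).
Proof.
move=> /subspace_continuousP fc phic Dphi x V /(fc _ (Dphi x)) /phic.
move=> VD; suff : nbhs x [set y | V (f (phi y))] by [].
have {VD} : nbhs x [set y | D (phi y) -> V (f (phi y))] by exact: VD.
by apply: filterS => y; exact.
Qed.

Lemma continuous_clamp0 : continuous (fun t : R => Num.max 0 t).
Proof.
move=> t; apply: (@continuous_max R R (cst 0) idfun t); [exact: cvg_cst|exact: cvg_id].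
Qed.

Lemma periodic1_unit_interval f u : periodic1 f ->
  f u = f (u - (Num.floor u)%:~R) .
Proof.
move=> fP; have fn (n : nat) x : f (x + n%:R) = f x.
  by elim: n => [|n IH]; rewrite ?addr0// -natr1 addrA fP.
case: (Num.floor u) => n.
  by rewrite -pmulrn; have := fn n (u - n%:R); rewrite subrK.
by rewrite NegzE mulrNz opprK -pmulrn fn.
Qed.

(** By periodicity the maximum over the line is a maximum over the compact
    set [0, T] x [0, 1]. *)
Lemma heat_maximum_principle b g w wu wuu A G T :
  advected_heat b g w wu wuu -> (forall u, `|w 0 u| <= A) ->
  (forall t u, 0 < t <= T -> `|g t u| <= G) ->
  forall t u, 0 <= t <= T -> `|w t u| <= A + G * t.
Proof.
move=> [wP wC wD wt] w0 gG t u tT.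
pose Z t (i : bool * R) := (-1) ^+ i.1 * w t i.2.
have Zle r i : Z r i <= `|w r i.2|.
  by rewrite (le_trans (ler_norm _))// normrM normrX normrN1 expr1n mul1r.
suff ZG : forall r i, 0 <= r <= T -> Z r i <= A + G * r.
  rewrite ler_norml; apply/andP; split.
    by have := ZG t (true, u) tT; rewrite /Z/= expr1; lra.
  by have := ZG t (false, u) tT; rewrite /Z/= expr0; lra.
apply: parabolic_comparison.
- by move=> i; exact: le_trans (Zle _ _) (w0 _).
- move=> c.
  pose F (p : R * R) := `|w (Num.max 0 p.1) p.2| - c * p.1.
  have FC : continuous F.
    move=> p; apply: cvgB; first by apply: cvg_norm; exact: wC.
    apply: cvgM; [exact: cvg_cst|exact: cvg_fst].
  have KC : compact (`[0, T] `*` `[0, 1] : set (R * R)).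
    by apply: compact_setX; exact: segment_compact.
  have [|[r x] /= rx rxmax] := compact_EVT_max _ KC (continuous_subspaceT FC).
    exists (0, 0); rewrite /= !in_itv/= !lexx ler01 (le_trans _ (andP tT).2)//.
    by case/andP: tT.
  move: rx; rewrite inE/= !in_itv/= => -[rT x01].
  (* the sign that makes Z equal to the absolute value of w *)
  exists r, (w r x < 0, x); split=> // s j sT.
  have /andP[r0 _] := rT; have /andP[s0 _] := sT.
  have -> : Z r (w r x < 0, x) = `|w r x|.
    by rewrite /Z/= normrEsign mulr_sign; case: ltP.
  apply: (@le_trans _ _ (`|w s j.2| - c * s)); first by rewrite lerD2r Zle.
  rewrite (periodic1_unit_interval j.2 (wP _ s0)).
  have := rxmax (s, j.2 - (Num.floor j.2)%:~R).
  rewrite /F/= !max_r//; apply; rewrite inE/= !in_itv/=; split=> //.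
  have /andP[] := floor_itv j.2; rewrite intrD; lra.
- move=> r [e x] /andP[r0 rT] rmax.
  have [wxd wxdd] := wD r x r0.
  exists ((-1) ^+ e * (wuu r x + b * wu r x + g r x)).
    by apply: is_derive_lambdaZ; exact: wt.
  have fd s : is_derive s 1 (fun y => (-1) ^+ e * w r y) ((-1) ^+ e * wu r s).
    by apply: is_derive_lambdaZ; have [] := wD r s r0.
  have fdd : is_derive x 1 (fun y => (-1) ^+ e * wu r y) ((-1) ^+ e * wuu r x).
    exact: is_derive_lambdaZ.
  have [s|E1 E2] := second_derivative_test fd fdd _; first exact: (rmax (e, s)).
  have -> : (-1) ^+ e * (wuu r x + b * wu r x + g r x) =
     (-1) ^+ e * wuu r x + b * ((-1) ^+ e * wu r x) + (-1) ^+ e * g r x by ring.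
  rewrite E1 mulr0 addr0 -[G]add0r lerD// (le_trans (ler_norm _))//.
  by rewrite normrM normrX normrN1 expr1n mul1r gG// r0.
Qed.

(** The coefficients are constant, so the equation commutes with
    translations. *)
Lemma advected_heat_dquot h b g w wu wuu : advected_heat b g w wu wuu ->
  advected_heat b (fun t => dquot h (g t)) (fun t => dquot h (w t))
    (fun t => dquot h (wu t)) (fun t => dquot h (wuu t)).
Proof.
move=> [wP wC wD wt]; split.
- by move=> t t0 u; rewrite /dquot addrAC !wP.
- have shiftC : continuous (fun p : R * R => (p.1, p.2 + h)).
    move=> p; apply: (@cvg_pair _ _ _ (nbhs p) (nbhs p.1) (nbhs (p.2 + h))).
      exact: cvg_fst.
    by apply: cvgD; [exact: cvg_snd|exact: cvg_cst].
  move=> p; apply: cvgM; first exact: cvg_cst.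
  apply: cvgB; last exact: wC.
  exact: (continuous_comp (shiftC p) (wC _)).
- move=> t u t0; have [H1 H2] := wD t u t0; have [H3 H4] := wD t (u + h) t0.
  by split; apply: dquot_derive.
- move=> t u t0.
  have -> : dquot h (wuu t) u + b * dquot h (wu t) u + dquot h (g t) u =
    h^-1 * ((wuu t (u + h) + b * wu t (u + h) + g t (u + h))
            - (wuu t u + b * wu t u + g t u)) by rewrite /dquot; ring.
  by apply: is_derive_lambdaZ; apply: is_derive_lambdaB; exact: wt.
Qed.

(** Propagation of regularity: the maximum principle applied to each iterated
    difference quotient of the solution. *)
Lemma advected_heat_dquot_bounded k b g w wu wuu A G T t :
  advected_heat b g w wu wuu -> dquot_bounded k A (w 0) -> 0 <= G ->
  (forall s, 0 < s <= T -> dquot_bounded k G (g s)) -> 0 <= t <= T ->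
  dquot_bounded k (A + G * T) (w t).
Proof.
elim: k g w wu wuu => [|k IH] g w wu wuu wH w0 G0 gG tT.
all: have wAG u : `|w t u| <= A + G * T.
1,3: have /andP[_ tT'] := tT.
1,2: apply: (@le_trans _ _ (A + G * t)); last by rewrite lerD2l ler_wpM2l.
1,2: apply: (heat_maximum_principle wH) tT => [x|r x rT]; 
  [exact: dquot_bounded_norm w0|exact: dquot_bounded_norm (gG _ rT)].
  by [].
split => // h h0; apply: (IH _ _ _ _ (advected_heat_dquot h wH)) => //.
  by case: w0 => _; exact.
by move=> s /gG[_]; exact.
Qed.

End HeatEquation.

(** * Stability of the discrete equations *)

Section DiscreteTorus.
Set Implicit Arguments.
Unset Strict Implicit.
Unset Printing Implicit Defensive.
Local Open Scope classical_set_scope.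
Local Open Scope ring_scope.
Variables (R : realType) (N : nat).
Implicit Types (f : R -> R) (p q : 'I_N -> R) (x : 'I_N) (u h s t b A G K T : R).

Lemma lapNZ (c : R) p x : lapN (fun y => c * p y) x = c * lapN p x.
Proof. by rewrite /lapN; ring. Qed.

Lemma sgradNZ (c : R) p x : sgradN (fun y => c * p y) x = c * sgradN p x.
Proof. by rewrite /sgradN; ring. Qed.

Lemma lapNB p q x : lapN (fun y => p y - q y) x = lapN p x - lapN q x.
Proof. by rewrite /lapN; ring. Qed.

Lemma sgradNB p q x : sgradN (fun y => p y - q y) x = sgradN p x - sgradN q x.
Proof. by rewrite /sgradN; ring. Qed.

(** The forward gradient of the shifted product is centred in [x]; this
    symmetry makes the energy flux a function of [p] and its centred
    gradient. *)
Lemma gradN_product p x :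
  gradN (fun y => p (ord_pred y) * p y) x = 2 * (p x * sgradN p x).
Proof. by rewrite /gradN /sgradN ordSK; field. Qed.

(** The neighbours of [x] enter with the weights N^2 +- b N / 2, which can be
    negative for N < |b| / 2 but never below - b^2 / 16, since
    N^2 +- b N / 2 + b^2 / 16 = (N +- b / 4)^2.  Each neighbour differs from
    the maximum by at most 2 p(x), whence the bound, uniform in N. *)
Lemma advected_lapN_le_at_max b p x : (forall y, `|p y| <= p x) ->
  lapN p x + b * sgradN p x <= b ^+ 2 / 4 * p x.
Proof.
move=> pmax; rewrite /lapN /sgradN.
set n : R := N%:R; set a := p (ordS x); set c := p (ord_pred x); set m := p x.
have /andP[a1 a2] : - m <= a <= m by rewrite -ler_norml pmax.
have /andP[c1 c2] : - m <= c <= m by rewrite -ler_norml pmax.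
have m0 : 0 <= m by apply: le_trans (pmax x).
have : 0 <= (n + b / 4) ^+ 2 * (m - a) by rewrite mulr_ge0 ?sqr_ge0 ?subr_ge0.
have : 0 <= (n - b / 4) ^+ 2 * (m - c) by rewrite mulr_ge0 ?sqr_ge0 ?subr_ge0.
have : 0 <= b ^+ 2 / 16 * (m + a) by rewrite mulr_ge0 ?divr_ge0 ?sqr_ge0//; lra.
have : 0 <= b ^+ 2 / 16 * (m + c) by rewrite mulr_ge0 ?divr_ge0 ?sqr_ge0//; lra.
lra.
Qed.

(** Multiplying by exp (- b^2 t / 4) absorbs the growth allowed by
    [advected_lapN_le_at_max], after which the maximum principle applies to
    each N. *)
Lemma discrete_stability b (w g : R -> 'I_N -> R) G T :
  (forall x, w 0 x = 0) ->
  (forall x, continuous (fun t : R => w (Num.max 0 t) x)) ->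
  (forall t x, 0 < t -> is_derive t 1 (fun s : R => w s x)
     (lapN (w t) x + b * sgradN (w t) x + g t x)) ->
  (forall t x, 0 < t <= T -> `|g t x| <= G) ->
  forall t x, 0 <= t <= T -> `|w t x| <= expR (b ^+ 2 / 4 * t) * (G * t).
Proof.
move=> w0 wC wd gG t x tT.
pose lam := b ^+ 2 / 4; have lam0 : 0 <= lam by rewrite divr_ge0 ?sqr_ge0.
pose W t y := expR (- lam * t) * w t y.
pose Z t (i : bool * 'I_N) := (-1) ^+ i.1 * W t i.2.
have normZ r e y : `|(-1) ^+ e * W r y| = `|W r y|.
  by rewrite normrM normrX normrN1 expr1n mul1r.
suff ZG : forall r i, 0 <= r <= T -> Z r i <= 0 + G * r.
  have WG : `|W t x| <= G * t.
    rewrite ler_norml; apply/andP; split.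
      by have := ZG t (true, x) tT; rewrite /Z/= expr1; lra.
    by have := ZG t (false, x) tT; rewrite /Z/= expr0; lra.
  have -> : w t x = expR (lam * t) * W t x.
    by rewrite /W mulrA -expRD mulNr subrr expR0 mul1r.
  by rewrite normrM gtr0_norm ?expR_gt0// ler_wpM2l// expR_ge0.
apply: parabolic_comparison.
- by move=> i; rewrite /Z /W w0 !mulr0.
- move=> c.
  pose F y r := `|expR (- lam * r) * w (Num.max 0 r) y| - c * r.
  have FC y : continuous (F y).
    move=> r; apply: cvgB; last by apply: cvgM; [exact: cvg_cst|exact: cvg_id].
    apply: cvg_norm; apply: cvgM; last exact: wC.
    apply: (@continuous_comp _ _ _ (fun r : R => - lam * r) expR); last exact: continuous_expR.
    by apply: cvgM; [exact: cvg_cst|exact: cvg_id].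
  have T0 : 0 <= T by case/andP: tT; exact: le_trans.
  have /choice[r rP] : forall y, exists r : R, 0 <= r <= T /\
      forall s, 0 <= s <= T -> F y s <= F y r.
    move=> y; have [r rT rmax] := EVT_max T0 (continuous_subspaceT (FC y)).
    by move: rT; rewrite in_itv/= => rT; exists r.
  pose y := [arg max_(y > x) F y (r y)]%O.
  have ymax z : F z (r z) <= F y (r y).
    by rewrite /y; case: Order.TotalTheory.arg_maxP => // i _; exact.
  have FE z s : 0 <= s -> F z s = `|W s z| - c * s by move=> s0; rewrite /F max_r.
  (* the sign that makes Z equal to the absolute value of W *)
  exists (r y), (W (r y) y < 0, y); have [ryT rymax] := rP y; split=> // s j sT.
  have -> : Z (r y) (W (r y) y < 0, y) = `|W (r y) y|.
    by rewrite /Z/= normrEsign mulr_sign; case: ltP.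
  apply: (@le_trans _ _ (`|W s j.2| - c * s)).
    by rewrite lerD2r /Z -(normZ s j.1 j.2) ler_norm.
  have /andP[s0 _] := sT; have /andP[ry0 _] := ryT.
  rewrite -!FE//; apply: le_trans (ymax j.2).
  by have [_] := rP j.2; exact.
- move=> r [e y] /andP[r0 rT] rmax.
  have Wmax z : `|(-1) ^+ e * W r z| <= (-1) ^+ e * W r y.
    rewrite normZ ler_norml; apply/andP; split.
      by have := rmax (true, z); rewrite /Z/= expr1; lra.
    by have := rmax (false, z); rewrite /Z/= expr0; lra.
  exists ((-1) ^+ e * (- lam * W r y + expR (- lam * r) *
            (lapN (w r) y + b * sgradN (w r) y + g r y))).
    apply: is_derive_lambdaZ.
    have -> : - lam * W r y = expR (- lam * r) * (- lam * 1) * w r y.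
      by rewrite /W; ring.
    apply: is_derive_lambdaM; last exact: wd.
  have := advected_lapN_le_at_max b Wmax.
  rewrite lapNZ sgradNZ /W lapNZ sgradNZ.
  have : (-1) ^+ e * (expR (- lam * r) * g r y) <= G.
    rewrite (le_trans (ler_norm _))// normrM normrX normrN1 expr1n mul1r normrM.
    rewrite -[G]mul1r ler_pM// ?gG ?r0// ger0_norm ?expR_ge0//.
    by rewrite -expR0 ler_expR mulNr oppr_le0 mulr_ge0// ltW.
  rewrite -/lam; lra.
Qed.

Lemma pt_ordS f x : periodic1 f -> f (pt R (ordS x)) = f (pt R x + N%:R^-1).
Proof.
move=> fP; rewrite /pt /ordS/=.
have N0 : N%:R != 0 :> R by rewrite pnatr_eq0 -lt0n (leq_ltn_trans _ (ltn_ord x)).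
have [xN|] := ltnP x.+1 N.
  by rewrite modn_small// -natr1 mulrDl mul1r.
move=> Nx; have -> : x.+1 = N by apply/eqP; rewrite eqn_leq Nx ltn_ord.
have -> : pt R x + N%:R^-1 = 0 + 1.
  have E : N%:R = x%:R + 1 :> R.
    by rewrite natr1; congr (_%:R); apply/eqP; rewrite eqn_leq Nx ltn_ord.
  by rewrite add0r /pt -[X in _ + X]mul1r -mulrDl -E divff.
by rewrite fP modnn mul0r.
Qed.

Lemma pt_ord_pred f x : periodic1 f -> f (pt R (ord_pred x)) = f (pt R x - N%:R^-1).
Proof.
move=> fP.
have gP : periodic1 (fun u => f (u - N%:R^-1)) by move=> u; rewrite addrAC fP.
by have := pt_ordS (ord_pred x) gP; rewrite ord_predK addrK => ->.
Qed.

Lemma lapN_sample f x : periodic1 f -> let h := N%:R^-1 in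
  lapN (fun y => f (pt R y)) x =
  h ^- 2 * (f (pt R x + h) + f (pt R x - h) - 2 * f (pt R x)).
Proof. by move=> fP h; rewrite /lapN pt_ordS// pt_ord_pred// /h exprVn invrK. Qed.

Lemma sgradN_sample f x : periodic1 f -> let h := N%:R^-1 in
  sgradN (fun y => f (pt R y)) x =
  2^-1 * (h^-1 * (f (pt R x + h) - f (pt R x - h))).
Proof.
by move=> fP h; rewrite /sgradN pt_ordS// pt_ord_pred// /h invrK; ring.
Qed.

End DiscreteTorus.

(** * Error estimates *)

Section Convergence.
Set Implicit Arguments.
Unset Strict Implicit.
Unset Printing Implicit Defensive.
Local Open Scope classical_set_scope.
Local Open Scope ring_scope.
Variable R : realType.
Implicit Types (f : R -> R) (v e : R -> R -> R) (u h s t b A G K T : R).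

Lemma smooth_dquot_bounded k f : Cb_infty_torus f -> exists A, dquot_bounded k A f.
Proof.
move=> [_ fs].
have [A fA] : exists A, forall j u, (j <= k)%N -> `|derive1n j f u| <= A.
  elim: k => [|k [A fA]].
    have [_ [A fA]] := fs 0%N.
    by exists A => j u; rewrite leqn0 => /eqP ->; exact: fA.
  have [_ [B fB]] := fs k.+1.
  exists (Num.max A B) => j u; rewrite leq_eqVlt => /orP[/eqP ->|jk].
    by rewrite le_max fB orbT.
  by rewrite le_max fA.
exists A; apply: (@dquot_bounded_smooth _ k A (fun j => derive1n j f)) => j u; last exact: fA.
by rewrite derive1nS derive1E; apply: derivableP; have [] := fs j.
Qed.

Lemma derivable_is_derive1 f u : derivable f u 1 -> is_derive u 1 f (derive1 f u).
Proof. by move=> fd; rewrite derive1E; exact: derivableP. Qed.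

Lemma classical_advected_heat b (g : R -> R -> R) v : classical_regularity v ->
  (forall t u, 0 < t ->
    derive1 (fun s => v s u) t = derive1n 2 (v t) u + b * derive1 (v t) u + g t u) ->
  advected_heat b g v (fun t => derive1 (v t)) (fun t => derive1n 2 (v t)).
Proof.
move=> [vP vC vt vx] veq; split.
- exact: vP.
- have clampC : continuous (fun p : R * R => (Num.max 0 p.1, p.2)).
    move=> p; apply: (@cvg_pair _ _ _ (nbhs p) (nbhs (Num.max 0 p.1)) (nbhs p.2)).
      apply: (@continuous_comp _ _ _ fst (fun t : R => Num.max 0 t)).
        exact: cvg_fst.
      exact: continuous_clamp0.
    exact: cvg_snd.
  have clamp0 (p : R * R) : [set p : R * R | 0 <= p.1] (Num.max 0 p.1, p.2).
    by rewrite /= le_max lexx.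
  exact: (continuous_comp_within vC clampC clamp0).
- by move=> t u t0; have [? ?] := vx t u t0; split; exact: derivable_is_derive1.
- by move=> t u t0; rewrite -veq//; apply: derivable_is_derive1; exact: vt.
Qed.

Lemma continuous_clamp_within f : {within `[0, +oo[, continuous f} ->
  continuous (fun t => f (Num.max 0 t)).
Proof.
move=> fC.
have clamp0 t : `[0, +oo[%classic (Num.max 0 t) by rewrite /= in_itv/= andbT le_max lexx.
exact: (continuous_comp_within fC (@continuous_clamp0 R) clamp0).
Qed.

Lemma sample_clamp_continuous b (g v vu vuu : R -> R -> R) u : advected_heat b g v vu vuu ->
  continuous (fun t => v (Num.max 0 t) u).
Proof.
move=> [_ vC _ _] t.
apply: (@continuous_comp _ _ _ (fun t : R => (t, u)) (fun p => v (Num.max 0 p.1) p.2)).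
  by apply: (@cvg_pair _ _ _ (nbhs t) (nbhs t) (nbhs u)); [exact: cvg_id|exact: cvg_cst].
exact: vC.
Qed.

Lemma sgradN_truncation (N : nat) K f df (x : 'I_N) :
  periodic1 f -> (forall s, is_derive s 1 f (df s)) -> dquot_bounded 2 K df ->
  `|sgradN (fun y => f (pt R y)) x - df (pt R x)| <= K * N%:R^-1 ^+ 2.
Proof.
move=> fP fd dK; have K0 := dquot_bounded_ge0 dK.
have h0 : 0 < N%:R^-1 :> R by rewrite invr_gt0 ltr0n (leq_ltn_trans _ (ltn_ord x)).
rewrite sgradN_sample//.
have := centered_difference_truncation (pt R x) h0 fd dK.
set D := _ * (_ - _); rewrite !ler_norml => /andP[D1 D2].
have : 0 <= K * N%:R^-1 ^+ 2 by rewrite mulr_ge0 ?sqr_ge0.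
by move=> ?; apply/andP; split; lra.
Qed.

(** Order 2 is needed: the energy flux contains a lattice gradient of
    this error, that is, the error multiplied by N. *)
Lemma velocity_error alpha K T v vu vuu (N : nat) (vN : R -> 'I_N -> R) :
  advected_heat (2 * alpha) (fun _ _ => 0) v vu vuu ->
  (forall t, 0 < t <= T -> dquot_bounded 4 K (v t)) ->
  (forall x, vN 0 x = v 0 (pt R x)) ->
  (forall x, continuous (fun t : R => vN (Num.max 0 t) x)) ->
  (forall t x, 0 < t -> is_derive t 1 (fun s => vN s x)
     (lapN (vN t) x + 2 * alpha * sgradN (vN t) x)) ->
  forall t x, 0 <= t <= T ->
  `|vN t x - v t (pt R x)|
   <= expR ((2 * alpha) ^+ 2 / 4 * t) * ((1 + 2 * `|alpha|) * K * N%:R^-1 ^+ 2 * t).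
Proof.
move=> vH vK vN0 vNC vNd t x tT; have [vP vC vD vt] := vH.
have h0 : 0 < N%:R^-1 :> R by rewrite invr_gt0 ltr0n (leq_ltn_trans _ (ltn_ord x)).
apply: (discrete_stability (b := 2 * alpha) (w := fun t x => vN t x - v t (pt R x))
  (g := fun t x => (lapN (fun y => v t (pt R y)) x - vuu t (pt R x)) +
    2 * alpha * (sgradN (fun y => v t (pt R y)) x - vu t (pt R x)))) tT.
- by move=> y; rewrite vN0 subrr.
- move=> y r; apply: cvgB; first exact: vNC.
  exact: (sample_clamp_continuous vH).
- move=> r y r0; rewrite lapNB sgradNB.
  set L := lapN (fun y => v r (pt R y)) y; set S := sgradN (fun y => v r (pt R y)) y.
  have -> : lapN (vN r) y - L + 2 * alpha * (sgradN (vN r) y - S) +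
     (L - vuu r (pt R y) + 2 * alpha * (S - vu r (pt R y))) =
     (lapN (vN r) y + 2 * alpha * sgradN (vN r) y) -
     (vuu r (pt R y) + 2 * alpha * vu r (pt R y) + 0) by ring.
  by apply: is_derive_lambdaB; [exact: vNd|exact: vt].
- move=> r y /[dup] rT /andP[r0 _].
  have vd s : is_derive s 1 (v r) (vu r s) by have [] := vD r s r0.
  have vdd s : is_derive s 1 (vu r) (vuu r s) by have [] := vD r s r0.
  have K1 := dquot_bounded_derive vd (vK _ rT).
  have K2 := dquot_bounded_derive vdd K1.
  have vPr : periodic1 (v r) by apply: vP; exact: ltW.
  have H1 := laplacian_truncation_quadratic (pt R y) h0 vd vdd K2.
  have H2 := sgradN_truncation y vPr vd (dquot_boundedW K1).
  rewrite lapN_sample// (le_trans (ler_normD _ _))//.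
  have -> : (1 + 2 * `|alpha|) * K * N%:R^-1 ^+ 2 =
    K * N%:R^-1 ^+ 2 + 2 * `|alpha| * (K * N%:R^-1 ^+ 2) by ring.
  by rewrite lerD// normrM [`|2 * alpha|]normrM ger0_norm// ler_wpM2l//.
Qed.

(** With w = p - f on the lattice and S the centred gradient of f,
    p (grad p) - f f' = p (grad w) + w S + f (S - f').
    The first term, where grad w is bounded by N times the bound on w,
    determines the order h. *)
Lemma energy_flux_error (N : nat) K C f df p (x : 'I_N) :
  0 <= C -> periodic1 f -> (forall s, is_derive s 1 f (df s)) ->
  (forall u, `|f u| <= K) -> dquot_bounded 2 K df ->
  (forall y, `|p y - f (pt R y)| <= C * N%:R^-1 ^+ 2) ->
  `|p x * sgradN p x - f (pt R x) * df (pt R x)| <= (C + K) ^+ 2 * N%:R^-1.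
Proof.
move=> C0 fP fd fK dK pf.
have K0 := dquot_bounded_ge0 dK.
have N0 : (0 < N)%N := leq_ltn_trans (leq0n _) (ltn_ord x).
set h : R := N%:R^-1 in pf *.
have h0 : 0 < h by rewrite invr_gt0 ltr0n.
have hV0 : 0 < h^-1 by rewrite /h invrK ltr0n.
have h1 : h <= 1 by rewrite invf_le1 ?ltr0n// ler1n.
have hh : h ^+ 2 <= h by rewrite expr2 ler_piMl// ltW.
set w := fun y => p y - f (pt R y).
have sw : `|sgradN w x| <= C * h.
  have -> : sgradN w x = 2^-1 * (h^-1 * w (ordS x)) - 2^-1 * (h^-1 * w (ord_pred x)).
    by rewrite /sgradN /h invrK; ring.
  have Hw y : `|2^-1 * (h^-1 * w y)| <= 2^-1 * (C * h).
    rewrite normrM gtr0_norm ?invr_gt0// ler_wpM2l ?invr_ge0//.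
    rewrite normrM (gtr0_norm hV0) ler_pdivrMl// (le_trans (pf _))//.
    by rewrite expr2 (mulrCA h).
  rewrite (le_trans (ler_normB _ _))// (le_trans (lerD (Hw _) (Hw _)))//; lra.
have pK : `|p x| <= C + K.
  have -> : p x = w x + f (pt R x) by rewrite /w subrK.
  rewrite (le_trans (ler_normD _ _))// lerD// (le_trans (pf x))// ler_piMr//.
  exact: le_trans hh h1.
have sf : `|sgradN (fun y => f (pt R y)) x| <= K.
  rewrite sgradN_sample// -/h.
  have H : `|f (pt R x + h) - f (pt R x - h)| <= K * (2 * h).
    have := increment_le (pt R x - h) (2 * h) fd (fun s => dquot_bounded_norm s dK).
    have -> : pt R x - h + 2 * h = pt R x + h by ring.
    by rewrite [`|2 * h|]ger0_norm// mulr_ge0// ltW.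
  rewrite normrM gtr0_norm ?invr_gt0// ler_pdivrMl// normrM (gtr0_norm hV0).
  by rewrite ler_pdivrMl// (le_trans H)//; lra.
have tf := sgradN_truncation x fP fd dK.
set S := sgradN (fun y => f (pt R y)) x in sf tf.
have spE : sgradN p x = sgradN w x + S by rewrite /w sgradNB subrK.
have -> : p x * sgradN p x - f (pt R x) * df (pt R x) =
  p x * sgradN w x + w x * S + f (pt R x) * (S - df (pt R x)).
  by rewrite spE /w; ring.
have -> : (C + K) ^+ 2 * h = (C + K) * (C * h) + C * h * K + K * (K * h) by ring.
rewrite (le_trans (ler_normD _ _))// lerD//.
  rewrite (le_trans (ler_normD _ _))// lerD//; rewrite normrM ler_pM//.
  by rewrite (le_trans (pf x))// ler_wpM2l.
by rewrite normrM ler_pM// (le_trans tf)// ler_wpM2l.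
Qed.

(** Without drift the stability estimate has no exponential factor. *)
Lemma energy_error alpha M Q T v vu e eu euu (N : nat) (vN eN : R -> 'I_N -> R) :
  advected_heat 0 (fun t u => 4 * alpha * (v t u * vu t u)) e eu euu ->
  (forall t, 0 < t <= T -> dquot_bounded 3 M (e t)) ->
  (forall t x, 0 < t <= T ->
    `|vN t x * sgradN (vN t) x - v t (pt R x) * vu t (pt R x)| <= Q * N%:R^-1) ->
  (forall x, eN 0 x = e 0 (pt R x)) ->
  (forall x, continuous (fun t : R => eN (Num.max 0 t) x)) ->
  (forall t x, 0 < t -> is_derive t 1 (fun s => eN s x)
     (lapN (eN t) x + 4 * alpha * (vN t x * sgradN (vN t) x))) ->
  forall t x, 0 <= t <= T ->
  `|eN t x - e t (pt R x)| <= (2 * M + 4 * `|alpha| * Q) * N%:R^-1 * t.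
Proof.
move=> eH eM fluxQ eN0 eNC eNd t x tT; have [eP eC eD et] := eH.
have h0 : 0 < N%:R^-1 :> R by rewrite invr_gt0 ltr0n (leq_ltn_trans _ (ltn_ord x)).
pose z t x := eN t x - e t (pt R x).
pose g t x := (lapN (fun y => e t (pt R y)) x - euu t (pt R x)) +
    4 * alpha * (vN t x * sgradN (vN t) x - v t (pt R x) * vu t (pt R x)).
have z0 (y : 'I_N) : z 0 y = 0 by rewrite /z eN0 subrr.
have zC (y : 'I_N) : continuous (fun t : R => z (Num.max 0 t) y).
  by move=> r; apply: cvgB; [exact: eNC|exact: (sample_clamp_continuous eH)].
have zd (r : R) (y : 'I_N) : 0 < r ->
    is_derive r 1 (fun s : R => z s y) (lapN (z r) y + 0 * sgradN (z r) y + g r y).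
  move=> r0; rewrite /g lapNB mul0r addr0.
  set L := lapN (fun y => e r (pt R y)) y.
  set F := vN r y * _; set E := v r _ * _.
  have -> : lapN (eN r) y - L + (L - euu r (pt R y) + 4 * alpha * (F - E)) =
    (lapN (eN r) y + 4 * alpha * F) -
    (euu r (pt R y) + 0 * eu r (pt R y) + 4 * alpha * E) by ring.
  by apply: is_derive_lambdaB; [exact: eNd|exact: et].
have gG (r : R) (y : 'I_N) : 0 < r <= T -> `|g r y| <= (2 * M + 4 * `|alpha| * Q) * N%:R^-1.
  move=> /[dup] rT /andP[r0 _].
  have ed s : is_derive s 1 (e r) (eu r s) by have [] := eD r s r0.
  have edd s : is_derive s 1 (eu r) (euu r s) by have [] := eD r s r0.
  have M1 := dquot_bounded_derive edd (dquot_bounded_derive ed (eM _ rT)).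
  have ePr : periodic1 (e r) by apply: eP; exact: ltW.
  have H := laplacian_truncation_linear (pt R y) h0 ed edd M1.
  rewrite /g lapN_sample// (le_trans (ler_normD _ _))// [leRHS]mulrDl lerD//.
  rewrite normrM [`|4 * alpha|]normrM [`|4|]ger0_norm// -[leRHS]mulrA.
  by rewrite ler_wpM2l ?mulr_ge0// fluxQ.
have := discrete_stability z0 zC zd gG x tT.
by rewrite expr0n !mul0r expR0 mul1r.
Qed.

(** The summand 1 keeps the constant positive when K = 0. *)
Lemma ln_ratio_bound K (N : nat) : 0 <= K -> (2 <= N)%N ->
  K * N%:R^-1 <= (K / ln 2 + 1) * (ln N%:R / N%:R).
Proof.
move=> K0 N2.
have l2 : 0 < ln 2 :> R by rewrite ln_gt0// ltr1n.
have lN : ln 2 <= ln N%:R :> R by rewrite ler_ln ?posrE ?ltr0n ?ler_nat// (ltn_trans _ N2).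
rewrite mulrA ler_wpM2r ?invr_ge0// mulrDl mul1r -[leLHS]addr0 lerD//.
  by rewrite mulrAC ler_pdivlMr// ler_wpM2l.
by rewrite (le_trans (ltW l2)).
Qed.

End Convergence.

Theorem theorem2p8 (R : realType) (alpha T : R) (v0 e0 : R -> R)
    (mu : forall N : nat, probability (config R N) R)
    (alpha_gt0 : 0 < alpha) (T_gt0 : 0 < T)
    (v0_smooth : Cb_infty_torus v0) (e0_smooth : Cb_infty_torus e0)
    (e0_gt0 : forall u, 0 < e0 u)
    (chi0_gt0 : forall u, 0 < e0 u - v0 u ^+ 2)
    (mu_gaussian : forall N : nat, (0 < N)%N ->
       gaussian_product (fun x : 'I_N => v0 (pt R x))
         (fun x : 'I_N => e0 (pt R x) - v0 (pt R x) ^+ 2) (mu N))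
    (mu_bounds : exists C0 : R,
       [/\ 0 < C0,
           (limn_esup (fun N : nat => mean_sqnorm_m1 (mu N)) <= C0%:E)%E &
           (limn_esup (fun N : nat =>
              N%:R%:E * max_volume_correlation (mu N)) <= C0%:E)%E]) :
  exists C : R, 0 < C /\
    forall v e : R -> R -> R, pde_solution alpha v0 e0 v e ->
    forall N : nat, (2 <= N)%N ->
    forall vN eN : R -> 'I_N -> R,
      discrete_solution (alphaN alpha 1 N) v0 e0 vN eN ->
    forall t : R, 0 <= t <= T ->
    forall x : 'I_N,
      `|eN t x - e t (pt R x)| <= C * (ln N%:R / N%:R).
Proof.
have [K v0K] := smooth_dquot_bounded 4 v0_smooth.
have [A e0A] := smooth_dquot_bounded 3 e0_smooth.
have K0 := dquot_bounded_ge0 v0K; have A0 := dquot_bounded_ge0 e0A.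
(* S bounds the difference quotients of the source 4 alpha v v_u of e up to
   order 3, and M those of e itself *)
pose S := `|4 * alpha| * (2 ^+ 3 * (K * K)).
have S0 : 0 <= S by rewrite !mulr_ge0// exprn_ge0.
pose M := A + S * T.
have M0 : 0 <= M by rewrite addr_ge0// mulr_ge0// ltW.
(* Cv h^2 bounds the velocity error, Q h the flux error, and D h the energy
   error *)
pose Cv := expR ((2 * alpha) ^+ 2 / 4 * T) * ((1 + 2 * `|alpha|) * K * T).
have a0 : 0 <= 1 + 2 * `|alpha| by rewrite addr_ge0// mulr_ge0.
have Cv0 : 0 <= Cv by rewrite /Cv !mulr_ge0 ?expR_ge0// ltW.
pose Q := (Cv + K) ^+ 2.
pose D := (2 * M + 4 * `|alpha| * Q) * T.
have q0 : 0 <= 2 * M + 4 * `|alpha| * Q by rewrite addr_ge0// mulr_ge0 ?sqr_ge0 ?mulr_ge0.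
have D0 : 0 <= D by rewrite mulr_ge0// ltW.
exists (D / ln 2 + 1); split.
  by rewrite ltr_wpDl// divr_ge0// ln_ge0// ler1n.
move=> v e [[vreg ereg] init veq eeq] N N2 vN eN [dinit dC dv de] t tT x.
have N0 : N%:R != 0 :> R by rewrite pnatr_eq0 -lt0n (ltn_trans _ N2).
have aN : alphaN alpha 1 N * N%:R = alpha.
  by rewrite /alphaN powRN powRr1// -mulrA mulVf// mulr1.
have vH : advected_heat (2 * alpha) (fun _ _ => 0) v
    (fun t => derive1 (v t)) (fun t => derive1n 2 (v t)).
  by apply: classical_advected_heat => // r u r0; rewrite addr0; exact: veq.
have eH : advected_heat 0 (fun t u => 4 * alpha * (v t u * derive1 (v t) u)) e
    (fun t => derive1 (e t)) (fun t => derive1n 2 (e t)).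
  apply: classical_advected_heat => // r u r0; rewrite eeq//.
  have [_ _ vD _] := vH; have [vd _] := vD r u r0.
  rewrite mul0r addr0; congr (_ + _).
  have [_ ] := is_derive_lambdaM vd vd; rewrite -derive1E => Hd.
  under eq_fun do rewrite expr2.
  by rewrite Hd; ring.
have v00 : v 0 = v0 by apply/funext => u; have [] := init u.
have e00 : e 0 = e0 by apply/funext => u; have [] := init u.
have zero4 : dquot_bounded 4 0 (fun _ : R => 0 : R).
  apply: (@dquot_bounded_smooth _ 4 0 (fun _ _ => 0)) => j u _.
  by rewrite normr0.
have vK (r : R) : 0 <= r <= T -> dquot_bounded 4 K (v r).
  move=> rT; rewrite -[K]addr0 -(mul0r T).
  by apply: (advected_heat_dquot_bounded vH) rT => //; rewrite v00.
have eM (r : R) : 0 <= r <= T -> dquot_bounded 3 M (e r).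
  move=> rT; apply: (advected_heat_dquot_bounded eH) rT => //; first by rewrite e00.
  move=> s /andP[s0 sT]; apply: dquot_boundedZ.
  have vs : dquot_bounded 4 K (v s) by apply: vK; rewrite ltW.
  apply: dquot_boundedM; first exact: dquot_boundedW.
  apply: dquot_bounded_derive vs => u.
  by have [_ _ vD _] := vH; have [] := vD s u s0.
have vN0 (y : 'I_N) : vN 0 y = v 0 (pt R y) by rewrite v00; have [] := dinit y.
have eN0 (y : 'I_N) : eN 0 y = e 0 (pt R y) by rewrite e00; have [] := dinit y.
have vNC (y : 'I_N) : continuous (fun t : R => vN (Num.max 0 t) y).
  by have [H _] := dC y; exact: (continuous_clamp_within H).
have eNC (y : 'I_N) : continuous (fun t : R => eN (Num.max 0 t) y).
  by have [_ H] := dC y; exact: (continuous_clamp_within H).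
have vNd (r : R) (y : 'I_N) : 0 < r -> is_derive r 1 (fun s => vN s y)
    (lapN (vN r) y + 2 * alpha * sgradN (vN r) y).
  by move=> r0; rewrite -[in 2 * alpha]aN mulrA; exact: dv.
have eNd (r : R) (y : 'I_N) : 0 < r -> is_derive r 1 (fun s => eN s y)
    (lapN (eN r) y + 4 * alpha * (vN r y * sgradN (vN r) y)).
  move=> r0; have := de r y r0; rewrite gradN_product -(mulrA 2) aN.
  by congr (is_derive _ _ _ (_ + _)); ring.
have vK' (r : R) : 0 < r <= T -> dquot_bounded 4 K (v r).
  by move=> /andP[r0 rT]; apply: vK; rewrite ltW.
have eM' (r : R) : 0 < r <= T -> dquot_bounded 3 M (e r).
  by move=> /andP[r0 rT]; apply: eM; rewrite ltW.
have verr (r : R) (y : 'I_N) : 0 <= r <= T -> `|vN r y - v r (pt R y)| <= Cv * N%:R^-1 ^+ 2.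
  move=> rT; apply: le_trans (velocity_error vH vK' vN0 vNC vNd y rT) _.
  have /andP[r0 rT'] := rT.
  have -> : Cv * N%:R^-1 ^+ 2 = expR ((2 * alpha) ^+ 2 / 4 * T) *
    ((1 + 2 * `|alpha|) * K * N%:R^-1 ^+ 2 * T) by rewrite /Cv; ring.
  rewrite ler_pM ?expR_ge0//.
  - by rewrite !mulr_ge0// sqr_ge0.
  - by rewrite ler_expR ler_wpM2l// divr_ge0// sqr_ge0.
  - by rewrite ler_wpM2l// !mulr_ge0// sqr_ge0.
have flux (r : R) (y : 'I_N) : 0 < r <= T -> `|vN r y * sgradN (vN r) y
    - v r (pt R y) * derive1 (v r) (pt R y)| <= Q * N%:R^-1.
  move=> /[dup] rT /andP[r0 rT'].
  have [vP _ vD _] := vH.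
  have vd (u : R) : is_derive u 1 (v r) (derive1 (v r) u) by have [] := vD r u r0.
  have rT0 : 0 <= r <= T by rewrite ltW.
  apply: energy_flux_error => //.
  - by apply: vP; exact: ltW.
  - by move=> u; exact: dquot_bounded_norm (vK _ rT0).
  - exact: dquot_boundedW (dquot_bounded_derive vd (vK _ rT0)).
  - by move=> z; exact: verr.
apply: le_trans (ln_ratio_bound D0 N2).
apply: le_trans (energy_error eH eM' flux eN0 eNC eNd x tT) _.
rewrite /D [leRHS]mulrAC ler_wpM2l//; last by case/andP: tT.
by rewrite mulr_ge0 ?invr_ge0.
Qed.
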